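(* Let $D$ be a dendriform algebra of codimension $1$ in the vector space $E$. Suppose that $V$ is a space complement of $D$ in $E$ with basis $\{x\}$. Then: (1) The relation $\equiv$ is an equivalence relation on the set $\mathcal{F}(D)$ of flag datums of $D$. Moreover, with $H^2(D):=\mathcal{F}(D)/\equiv$, there exists a bijection $$\Upsilon:\mathbf{Extd}(E,D)\to H^2(D),\qquad[(E,\succ_E,\prec_E)]\mapsto[\Omega(D)],$$ where $\Omega(D)$ is the flag datum associated with $(E,\succ_E,\prec_E)$ (and the basis element $x$), and $[\cdot]$ denotes equivalence classes with respect to $\equiv$. (2) The relation $\approx$ is an equivalence relation on the set $\mathcal{F}(D)$. Moreover, with $H^2_V(D):=\mathcal{F}(D)/\approx$, there exists a bijection $$\Upsilon':\mathbf{Extd}'(E,D)\to H^2_V(D),\qquad\overline{(E,\succ_E,\prec_E)}\mapsto\overline{\Omega(D)},$$ where $\Omega(D)$ is the flag datum associated with $(E,\succ_E,\prec_E)$, and the bar denotes equivalence classes with respect to $\approx$.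
   Context: The base field is $\mathbf{k}=\mathbb{C}$. A dendriform algebra is a vector space $D$ with bilinear operations $\succ,\prec$ such that for all $x,y,z$: $(x\succ y+x\prec y)\succ z=x\succ(y\succ z)$; $(x\prec y)\prec z=x\prec(y\succ z+y\prec z)$; $(x\succ y)\prec z=x\succ(y\prec z)$. Write $\star:=\succ+\prec$. Morphisms are linear maps preserving both operations; isomorphisms are bijective morphisms. A space complement of $D$ in $E$ is a subspace $V$ with $E=D+V$, $D\cap V=\{0\}$. $\mathbf{Exts}(E,D)$ is the set of all dendriform algebra structures $(E,\succ_E,\prec_E)$ on $E$ having the dendriform algebra $D$ as a subalgebra. Let $\pi:E\to V$, $\pi(a+v)=v$, and $\rho:E\to D$, $\rho(a+v)=a$ ($a\in D$, $v\in V$). Two elements of $\mathbf{Exts}(E,D)$ are equivalent ($\equiv$) if there is an isomorphism of dendriform algebras $\psi:(E,\succ_E,\prec_E)\to(E,\succ'_E,\prec'_E)$ with $\psi(a)=a$ for all $a\in D$; cohomologous ($\approx$) if moreover $\psi$ can be chosen with $\pi\circ\psi=\pi$. $\mathbf{Extd}(E,D):=\mathbf{Exts}(E,D)/\equiv$, $\mathbf{Extd}'(E,D):=\mathbf{Exts}(E,D)/\approx$. A flag datum of $D$ is a 12-tuple $\Omega(D)=(l_1,l_2,r_1,r_2,p_1,p_2,q_1,q_2,a_1,a_2,\bar k_1,\bar k_2)$ of linear maps $l_1,l_2,r_1,r_2:D\to\mathbf{k}$, $p_1,p_2,q_1,q_2:D\to D$, elements $a_1,a_2\in D$ and scalars $\bar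 k_1,\bar k_2\in\mathbf{k}$ such that for all $a,b\in D$ the following hold; $\mathcal{F}(D)$ denotes the set of all flag datums. (F1) $l_1(a\star b)=l_1(a)l_1(b)$; $l_2(a\prec b)=l_2(a)(l_1(b)+l_2(b))$; $l_2(a\succ b)=l_1(a)l_2(b)$; $(r_1(a)+r_2(a))r_1(b)=r_1(a\succ b)$; $r_2(a)r_2(b)=r_2(a\star b)$; $r_1(a)r_2(b)=r_1(a\prec b)$; $l_2(a)r_1(b)=0$. (F2) $q_1(a\star b)=a\succ q_1(b)+q_1(a)l_1(b)$; $q_2(a\prec b)=a\prec(q_1(b)+q_2(b))+q_2(a)(l_1(b)+l_2(b))$; $q_2(a\succ b)=a\succ q_2(b)+q_1(a)l_2(b)$. (F3) $(p_1(a)+p_2(a))\succ b+(r_1(a)+r_2(a))p_1(b)=p_1(a\succ b)$; $p_2(a)\prec b+r_2(a)p_2(b)=p_2(a\star b)$; $p_1(a)\prec b+r_1(a)p_2(b)=p_1(a\prec b)$. (F4) $(q_1(a)+q_2(a))\succ b+(l_1(a)+l_2(a))p_1(b)=a\succ p_1(b)+q_1(a)r_1(b)$; $q_2(a)\prec b+l_2(a)p_2(b)=a\prec(p_1(b)+p_2(b))+q_2(a)(r_1(b)+r_2(b))$; $q_1(a)\prec b+l_1(a)p_2(b)=a\succ p_2(b)+q_1(a)r_2(b)$. (F5) $(a_1+a_2)\succ a+(\bar k_1+\bar k_2)p_1(a)=p_1(p_1(a))+a_1r_1(a)$; $a_2\prec a+\bar k_2p_2(a)=p_2(p_1(a)+p_2(a))+a_2(r_1(a)+r_2(a))$;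 $a_1\prec a+\bar k_1p_2(a)=p_1(p_2(a))+a_1r_2(a)$. (F6) $\bar k_2r_1(a)=r_1(p_1(a))$; $r_2(p_1(a)+p_2(a))+\bar k_2r_1(a)=0$; $r_1(p_2(a))=0$. (F7) $q_1(q_1(a)+q_2(a))+a_1(l_1(a)+l_2(a))=a\succ a_1+q_1(a)\bar k_1$; $q_2(q_2(a))+a_2l_2(a)=a\prec(a_1+a_2)+q_2(a)(\bar k_1+\bar k_2)$; $q_2(q_1(a))+a_2l_1(a)=a\succ a_2+q_1(a)\bar k_2$. (F8) $l_1(q_1(a)+q_2(a))+l_2(a)\bar k_1=0$; $l_2(q_2(a))=l_2(a)\bar k_1$; $l_2(q_1(a))=0$. (F9) $q_1(p_1(a)+p_2(a))+a_1(r_1(a)+r_2(a))=p_1(q_1(a))+a_1l_1(a)$; $q_2(p_2(a))+a_2r_2(a)=p_2(q_1(a)+q_2(a))+a_2(l_1(a)+l_2(a))$; $q_2(p_1(a))+a_2r_1(a)=p_1(q_2(a))+a_1l_2(a)$. (F10) $l_1(p_1(a)+p_2(a))+(r_1(a)+r_2(a))\bar k_1=r_1(q_1(a))+\bar k_1l_1(a)$; $l_2(p_2(a))+r_2(a)\bar k_2=r_2(q_1(a)+q_2(a))+\bar k_2(l_1(a)+l_2(a))$; $l_2(p_1(a))+r_1(a)\bar k_2=r_1(q_2(a))+\bar k_1l_2(a)$. (F11) $q_1(a_1+a_2)+a_1\bar k_2=p_1(a_1)$; $q_2(a_2)=p_2(a_1+a_2)+a_2\bar k_1$; $q_2(a_1)+a_2\bar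 k_1=p_1(a_2)+a_1\bar k_2$. (F12) $l_1(a_1+a_2)+\bar k_2\bar k_1=r_1(a_1)$; $l_2(a_2)=r_2(a_1+a_2)+\bar k_2\bar k_1$; $l_2(a_1)=r_1(a_2)$. Flag datum associated with $(E,\succ_E,\prec_E)\in\mathbf{Exts}(E,D)$: it is determined, for $a\in D$, by $l_1(a)x=\pi(a\succ_Ex)$, $l_2(a)x=\pi(a\prec_Ex)$, $r_1(a)x=\pi(x\succ_Ea)$, $r_2(a)x=\pi(x\prec_Ea)$, $p_1(a)=\rho(x\succ_Ea)$, $p_2(a)=\rho(x\prec_Ea)$, $q_1(a)=\rho(a\succ_Ex)$, $q_2(a)=\rho(a\prec_Ex)$, $a_1=\rho(x\succ_Ex)$, $a_2=\rho(x\prec_Ex)$, $\bar k_1x=\pi(x\succ_Ex)$, $\bar k_2x=\pi(x\prec_Ex)$. Two flag datums $\Omega(D)$ and $\Omega'(D)$ (with primed entries) are equivalent, $\Omega(D)\equiv\Omega'(D)$, if there exist $g_0\in D$ and $0\neq\bar h_0\in\mathbf{k}$ such that for all $a\in D$ and $i=1,2$ (writing $\bullet_1=\succ$, $\bullet_2=\prec$): $l'_i=l_i$; $r'_i=r_i$; $p'_i(a)=\frac1{\bar h_0}(p_i(a)+g_0r_i(a)-g_0\bullet_ia)$; $q'_i(a)=\frac1{\bar h_0}(q_i(a)+g_0l_i(a)-a\bullet_ig_0)$; $a'_i=\frac1{\bar h_0^2}\big(a_i+g_0\bar k_i-q_i(g_0)-g_0l_i(g_0)+g_0\bullet_ig_0-p_i(g_0)-g_0r_i(g_0)\big)$;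 $\bar k'_i=\frac1{\bar h_0}(\bar k_i-l_i(g_0)-r_i(g_0))$. They are cohomologous, $\Omega(D)\approx\Omega'(D)$, if this holds with $\bar h_0=1$. *)

(* Defs.v *)
From HB Require Import structures.
From mathcomp Require Import all_boot all_order all_algebra.
From mathcomp Require Import sesquilinear complex.
From mathcomp Require Import boolp classical_sets reals.

Set Implicit Arguments.
Unset Strict Implicit.
Unset Printing Implicit Defensive.

Import GRing.Theory.
Local Open Scope classical_set_scope.
Local Open Scope ring_scope.

Record dendriform (K : fieldType) (D : lmodType K) := Dendriform {
  dsucc : {bilinear D -> D -> D};
  dprec : {bilinear D -> D -> D};
  dstar_succ : forall x y z,
    dsucc (dsucc x y + dprec x y) z = dsucc x (dsucc y z);
  dprec_star : forall x y z,
    dprec (dprec x y) z = dprec x (dsucc y z + dprec y z);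
  dsucc_prec : forall x y z, dprec (dsucc x y) z = dsucc x (dprec y z) }.

Notation "x \succ[ A ] y" := (dsucc A x y)
  (at level 45, left associativity, format "x  \succ[ A ]  y") : ring_scope.
Notation "x \prec[ A ] y" := (dprec A x y)
  (at level 45, left associativity, format "x  \prec[ A ]  y") : ring_scope.
Notation "x \star[ A ] y" := (dsucc A x y + dprec A x y)
  (at level 45, left associativity, only parsing) : ring_scope.

Definition dendriform_iso (K : fieldType) (D D' : lmodType K)
    (A : dendriform D) (A' : dendriform D') (psi : {linear D -> D'}) : Prop :=
  [/\ bijective psi,
      {morph psi : x y / x \succ[A] y >-> x \succ[A'] y} &
      {morph psi : x y / x \prec[A] y >-> x \prec[A'] y}].

(* The set of classes of an equivalence relation R. *)
Definition quotient (T : Type) (R : T -> T -> Prop) : Type :=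
  {C : set T | exists x, C = [set y | R x y]}.

Definition class_of (T : Type) (R : T -> T -> Prop) (x : T) : quotient R :=
  exist _ [set y | R x y] (ex_intro _ x erefl).

(* A subspace of E is given by its type of elements, D : subLmodType SD with
   inclusion val : D -> E and SD the membership predicate. *)

Definition space_complement (K : fieldType) (E : lmodType K) (SD SV : pred E)
    (D : subLmodType SD) (V : subLmodType SV) : Prop :=
  (forall e : E, exists a : D, exists v : V, e = val a + val v) /\
  (forall e : E, e \in SD -> e \in SV -> e = 0).

(* The component in U of e in the decomposition E = U + W (junk value 0 when e
   has no decomposition). With D and V complementary in E,
   rho = proj_along D V and pi = proj_along V D. *)
Definition proj_along (K : fieldType) (E : lmodType K) (SU SW : pred E)
    (U : subLmodType SU) (W : subLmodType SW) (e : E) : U :=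
  xget 0 [set u : U | exists w : W, e = val u + val w].

Definition singleton_basis (K : fieldType) (V : lmodType K) (x : V) : Prop :=
  (forall c : K, c *: x = 0 -> c = 0) /\ (forall v : V, exists c, v = c *: x).

Section Extensions.
Variables (K : fieldType) (E : lmodType K) (SD SV : pred E).
Variables (D : subLmodType SD) (V : subLmodType SV) (A : dendriform D).

Record exts := Exts {
  exts_str :> dendriform E;
  exts_succ : forall a b : D, val (a \succ[A] b) = val a \succ[exts_str] val b;
  exts_prec : forall a b : D, val (a \prec[A] b) = val a \prec[exts_str] val b }.

Definition exts_equiv (s t : exts) : Prop :=
  exists psi : {linear E -> E},
    dendriform_iso s t psi /\ (forall a : D, psi (val a) = val a).

Definition exts_cohom (s t : exts) : Prop :=
  exists psi : {linear E -> E},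
    [/\ dendriform_iso s t psi,
        forall a : D, psi (val a) = val a &
        forall e : E, proj_along V D (psi e) = proj_along V D e].

Definition Extd : Type := quotient exts_equiv.
Definition Extd' : Type := quotient exts_cohom.

End Extensions.

Record flag_tuple (K : fieldType) (D : lmodType K) := FlagTuple {
  l1 : {scalar D}; l2 : {scalar D}; r1 : {scalar D}; r2 : {scalar D};
  p1 : {linear D -> D}; p2 : {linear D -> D};
  q1 : {linear D -> D}; q2 : {linear D -> D};
  a1 : D; a2 : D; k1 : K; k2 : K }.

Section FlagDatums.
Variables (K : fieldType) (D : lmodType K) (A : dendriform D).

Local Notation "x ≻ y" := (x \succ[A] y) (at level 45, left associativity).
Local Notation "x ≺ y" := (x \prec[A] y) (at level 45, left associativity).
Local Notation "x ⋆ y" := (x \star[A] y) (at level 45, left associativity).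

Record is_flag_datum (w : flag_tuple D) : Prop := IsFlagDatum {
  flag1_l : forall a b,
    [/\ l1 w (a ⋆ b) = l1 w a * l1 w b,
        l2 w (a ≺ b) = l2 w a * (l1 w b + l2 w b) &
        l2 w (a ≻ b) = l1 w a * l2 w b];
  flag1_r : forall a b,
    [/\ (r1 w a + r2 w a) * r1 w b = r1 w (a ≻ b),
        r2 w a * r2 w b = r2 w (a ⋆ b) &
        r1 w a * r2 w b = r1 w (a ≺ b)];
  flag1_lr : forall a b, l2 w a * r1 w b = 0;
  flag2 : forall a b,
    [/\ q1 w (a ⋆ b) = a ≻ q1 w b + l1 w b *: q1 w a,
        q2 w (a ≺ b)
          = a ≺ (q1 w b + q2 w b) + (l1 w b + l2 w b) *: q2 w a &
        q2 w (a ≻ b) = a ≻ q2 w b + l2 w b *: q1 w a];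
  flag3 : forall a b,
    [/\ (p1 w a + p2 w a) ≻ b + (r1 w a + r2 w a) *: p1 w b = p1 w (a ≻ b),
        p2 w a ≺ b + r2 w a *: p2 w b = p2 w (a ⋆ b) &
        p1 w a ≺ b + r1 w a *: p2 w b = p1 w (a ≺ b)];
  flag4 : forall a b,
    [/\ (q1 w a + q2 w a) ≻ b + (l1 w a + l2 w a) *: p1 w b
          = a ≻ p1 w b + r1 w b *: q1 w a,
        q2 w a ≺ b + l2 w a *: p2 w b
          = a ≺ (p1 w b + p2 w b) + (r1 w b + r2 w b) *: q2 w a &
        q1 w a ≺ b + l1 w a *: p2 w b = a ≻ p2 w b + r2 w b *: q1 w a];
  flag5 : forall a,
    [/\ (a1 w + a2 w) ≻ a + (k1 w + k2 w) *: p1 w a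
          = p1 w (p1 w a) + r1 w a *: a1 w,
        a2 w ≺ a + k2 w *: p2 w a
          = p2 w (p1 w a + p2 w a) + (r1 w a + r2 w a) *: a2 w &
        a1 w ≺ a + k1 w *: p2 w a = p1 w (p2 w a) + r2 w a *: a1 w];
  flag6 : forall a,
    [/\ k2 w * r1 w a = r1 w (p1 w a),
        r2 w (p1 w a + p2 w a) + k2 w * r1 w a = 0 &
        r1 w (p2 w a) = 0];
  flag7 : forall a,
    [/\ q1 w (q1 w a + q2 w a) + (l1 w a + l2 w a) *: a1 w
          = a ≻ a1 w + k1 w *: q1 w a,
        q2 w (q2 w a) + l2 w a *: a2 w
          = a ≺ (a1 w + a2 w) + (k1 w + k2 w) *: q2 w a &
        q2 w (q1 w a) + l1 w a *: a2 w = a ≻ a2 w + k2 w *: q1 w a];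
  flag8 : forall a,
    [/\ l1 w (q1 w a + q2 w a) + l2 w a * k1 w = 0,
        l2 w (q2 w a) = l2 w a * k1 w &
        l2 w (q1 w a) = 0];
  flag9 : forall a,
    [/\ q1 w (p1 w a + p2 w a) + (r1 w a + r2 w a) *: a1 w
          = p1 w (q1 w a) + l1 w a *: a1 w,
        q2 w (p2 w a) + r2 w a *: a2 w
          = p2 w (q1 w a + q2 w a) + (l1 w a + l2 w a) *: a2 w &
        q2 w (p1 w a) + r1 w a *: a2 w = p1 w (q2 w a) + l2 w a *: a1 w];
  flag10 : forall a,
    [/\ l1 w (p1 w a + p2 w a) + (r1 w a + r2 w a) * k1 w
          = r1 w (q1 w a) + k1 w * l1 w a,
        l2 w (p2 w a) + r2 w a * k2 w
          = r2 w (q1 w a + q2 w a) + k2 w * (l1 w a + l2 w a) &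
        l2 w (p1 w a) + r1 w a * k2 w = r1 w (q2 w a) + k1 w * l2 w a];
  flag11 :
    [/\ q1 w (a1 w + a2 w) + k2 w *: a1 w = p1 w (a1 w),
        q2 w (a2 w) = p2 w (a1 w + a2 w) + k1 w *: a2 w &
        q2 w (a1 w) + k1 w *: a2 w = p1 w (a2 w) + k2 w *: a1 w];
  flag12 :
    [/\ l1 w (a1 w + a2 w) + k2 w * k1 w = r1 w (a1 w),
        l2 w (a2 w) = r2 w (a1 w + a2 w) + k2 w * k1 w &
        l2 w (a1 w) = r1 w (a2 w)] }.

Record flag_datum := FlagDatum {
  flag_val :> flag_tuple D;
  flag_valP : is_flag_datum flag_val }.

Record flag_transform (g0 : D) (h0 : K) (w w' : flag_tuple D) : Prop :=
  FlagTransform {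
  tr_l : forall a, l1 w' a = l1 w a /\ l2 w' a = l2 w a;
  tr_r : forall a, r1 w' a = r1 w a /\ r2 w' a = r2 w a;
  tr_p : forall a,
    p1 w' a = h0^-1 *: (p1 w a + r1 w a *: g0 - g0 ≻ a) /\
    p2 w' a = h0^-1 *: (p2 w a + r2 w a *: g0 - g0 ≺ a);
  tr_q : forall a,
    q1 w' a = h0^-1 *: (q1 w a + l1 w a *: g0 - a ≻ g0) /\
    q2 w' a = h0^-1 *: (q2 w a + l2 w a *: g0 - a ≺ g0);
  tr_a :
    a1 w' = h0 ^- 2 *: (a1 w + k1 w *: g0 - q1 w g0 - l1 w g0 *: g0
                        + g0 ≻ g0 - p1 w g0 - r1 w g0 *: g0) /\
    a2 w' = h0 ^- 2 *: (a2 w + k2 w *: g0 - q2 w g0 - l2 w g0 *: g0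
                        + g0 ≺ g0 - p2 w g0 - r2 w g0 *: g0);
  tr_k :
    k1 w' = h0^-1 * (k1 w - l1 w g0 - r1 w g0) /\
    k2 w' = h0^-1 * (k2 w - l2 w g0 - r2 w g0) }.

Definition flag_equiv (w w' : flag_datum) : Prop :=
  exists g0 : D, exists2 h0 : K, h0 != 0 & flag_transform g0 h0 w w'.

Definition flag_cohom (w w' : flag_datum) : Prop :=
  exists g0 : D, flag_transform g0 1 w w'.

Definition H2 : Type := quotient flag_equiv.
Definition H2_V : Type := quotient flag_cohom.

End FlagDatums.

Record flag_associated (K : fieldType) (E : lmodType K) (SD SV : pred E)
    (D : subLmodType SD) (V : subLmodType SV) (A : dendriform D) (x : V)
    (s : exts A) (w : flag_tuple D) : Prop := FlagAssociated {
  assoc_l : forall a : D,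
    l1 w a *: x = proj_along V D (val a \succ[s] val x) /\
    l2 w a *: x = proj_along V D (val a \prec[s] val x);
  assoc_r : forall a : D,
    r1 w a *: x = proj_along V D (val x \succ[s] val a) /\
    r2 w a *: x = proj_along V D (val x \prec[s] val a);
  assoc_p : forall a : D,
    p1 w a = proj_along D V (val x \succ[s] val a) /\
    p2 w a = proj_along D V (val x \prec[s] val a);
  assoc_q : forall a : D,
    q1 w a = proj_along D V (val a \succ[s] val x) /\
    q2 w a = proj_along D V (val a \prec[s] val x);
  assoc_a :
    a1 w = proj_along D V (val x \succ[s] val x) /\
    a2 w = proj_along D V (val x \prec[s] val x);
  assoc_k :
    k1 w *: x = proj_along V D (val x \succ[s] val x) /\
    k2 w *: x = proj_along V D (val x \prec[s] val x) }.

(* Main.v *)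
Require Import Defs.
From HB Require Import structures.
From mathcomp Require Import all_boot all_order all_algebra.
From mathcomp Require Import sesquilinear complex.
From mathcomp Require Import boolp classical_sets reals.
From mathcomp Require Import ring.
From Corelib Require Import RelationClasses.

Set Implicit Arguments.
Unset Strict Implicit.
Unset Printing Implicit Defensive.

Import GRing.Theory.
Local Open Scope ring_scope.

(** Since E = D + K x with D of codimension one, a multiplication on E that
    extends the one of D is a bilinear map, so it is determined by the products
    of D with x, of x with D, and of x with itself. Splitting each product along
    D and x gives exactly one half of a flag tuple (maps l, r, p, q, an element
    a and a scalar k), and any such half comes from a bilinear map
    ([has_table_exists], [has_table_uniq], [mul_exists]). Thus a pair of
    multiplications on E is the same thing as a flag tuple.

    The dendriform axioms are identities between trilinear maps, so they hold on
    E as soon as they hold when each argument is x or lies in D. With three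
    arguments in D they are the axioms of D; the D and x components of the seven
    remaining cases are the flag conditions ([is_flag_datumP]). Hence extensions
    correspond bijectively to flag datums.

    A linear endomorphism psi of E fixing D is given by psi x = g + h x, and it
    is bijective iff h is nonzero ([shear_bijective]). Again by bilinearity, psi
    is a morphism iff it respects the products involving x, and solving these
    equations for the target table gives the transformation rule with
    parameters g and h ([morph_transformP]). So two extensions are equivalent
    iff their flag datums are. As psi also commutes with the projection onto K x
    iff h = 1, the same holds for the cohomology relations.

    A correspondence that relates every element on either side and matches the
    two relations transports the equivalence property and induces a bijection of
    quotients ([quotient_bijection]); in particular, the relations on flag
    datums are equivalences because those on extensions are, which only needs
    that isomorphisms fixing D can be composed and inverted. *)

(** * Linear and bilinear maps *)

(** Bundled linear maps differ only in their proofs of linearity, which are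
    identified by proof irrelevance. *)
Lemma linear_map_ext (K : pzRingType) (U : lmodType K) (W : zmodType)
    (s : K -> W -> W) (f g : {linear U -> W | s}) : f =1 g -> f = g.
Proof.
case: f => f [[f0] [fZ]]; case: g => g [[g0] [gZ]] /= /funext fg; subst g.
by rewrite (Prop_irrelevance f0 g0) (Prop_irrelevance fZ gZ).
Qed.

Definition mk_linear (K : pzRingType) (U W : lmodType K) (f : U -> W)
    (fl : linear f) : {linear U -> W} :=
  HB.pack f (GRing.isLinear.Build K U W *:%R f fl).

Definition mk_scalar (K : nzRingType) (U : lmodType K) (f : U -> K)
    (fl : scalar f) : {scalar U} :=
  HB.pack f (GRing.isLinear.Build K U K *%R f fl).

Definition mk_bilinear (K : nzRingType) (U U' W : lmodType K)
    (f : U -> U' -> W) (fl : bilinear_for *:%R *:%R f) :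
    {bilinear U -> U' -> W} :=
  HB.pack f (bilinear_isBilinear.Build K U U' W *:%R *:%R f fl).

Lemma bilinear_forD (K : nzRingType) (U U' W : lmodType K)
    (f g : U -> U' -> W) :
  bilinear_for *:%R *:%R f -> bilinear_for *:%R *:%R g ->
  bilinear_for *:%R *:%R (fun u v => f u v + g u v).
Proof.
move=> [fl fr] [gl gr].
by split=> u c v w; rewrite ?(fl, fr) ?(gl, gr) /= scalerDr addrACA.
Qed.

(** For applying a linear combination of hypotheses: in a commutative ring, the
    second premise is left to polynomial normalization. *)
Lemma eq_shift (V : zmodType) (u v u' v' : V) :
  u = v -> u' - v' = u - v -> u' = v'.
Proof. by move=> -> /eqP; rewrite subrr subr_eq0 => /eqP. Qed.

Section Trilinear.
Variables (K : fieldType) (E : lmodType K).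
Implicit Types m : {bilinear E -> E -> E}.

Definition trilinear (F : E -> E -> E -> E) : Prop :=
  [/\ forall v w, linear (fun u => F u v w),
      forall u w, linear (fun v => F u v w) &
      forall u v, linear (fun w => F u v w)].

Lemma trilinear_mull m1 m2 : trilinear (fun u v w => m1 (m2 u v) w).
Proof. by split=> ? ? c ? ?; rewrite ?linearPl ?linearPr ?linearPl. Qed.

Lemma trilinear_mulr m1 m2 : trilinear (fun u v w => m1 u (m2 v w)).
Proof.
by split=> ? ? c ? ?; rewrite ?linearPl ?linearPr ?linearPl ?linearPr.
Qed.

Lemma trilinearD F G :
  trilinear F -> trilinear G -> trilinear (fun u v w => F u v w + G u v w).
Proof.
move=> [F1 F2 F3] [G1 G2 G3].
by split=> ? ? c ? ?;
  rewrite ?(F1, G1) ?(F2, G2) ?(F3, G3) scalerDr addrACA.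
Qed.

End Trilinear.

(** * Coordinates adapted to a subspace of codimension one *)

Section Coordinates.
Variables (K : fieldType) (E : lmodType K) (SD : pred E) (D : subLmodType SD).
Variable x : E.

Definition pt (a : D) (c : K) : E := val a + c *: x.

(** Coordinates that are linear by construction and scalar along x, unlike the
    projections [proj_along], whose linearity depends on the decomposition. They
    let an equation in E be split into one in D and one in K. *)
Record adapted_coord := AdaptedCoord {
  dpart : {linear E -> D};
  xpart : {scalar E};
  ptK : forall e, pt (dpart e) (xpart e) = e;
  dpart_pt : forall a c, dpart (pt a c) = a;
  xpart_pt : forall a c, xpart (pt a c) = c }.

Lemma ptD a b c d : pt a c + pt b d = pt (a + b) (c + d).
Proof. by rewrite /pt raddfD /= scalerDl addrACA. Qed.

Lemma ptZ c a d : c *: pt a d = pt (c *: a) (c * d).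
Proof. by rewrite /pt linearZ /= scalerDr scalerA. Qed.

Lemma pt_a0 a : pt a 0 = val a.
Proof. by rewrite /pt scale0r addr0. Qed.

Lemma pt_01 : pt 0 1 = x.
Proof. by rewrite /pt raddf0 scale1r add0r. Qed.

Lemma valD (a b : D) : val a + val b = val (a + b).
Proof. by rewrite raddfD. Qed.

Variable C : adapted_coord.

(** An equality of propositions rather than an equivalence, so that it can
    rewrite all the equations of a conjunction at once. *)
Lemma pt_eq a b c d : (pt a c = pt b d) = (a = b /\ c = d) :> Prop.
Proof.
apply/propext; split=> [e | [-> ->] //]; split.
  by rewrite -(dpart_pt C a c) e dpart_pt.
by rewrite -(xpart_pt C a c) e xpart_pt.
Qed.

Lemma dpart_val (a : D) : dpart C (val a) = a.
Proof. by rewrite -pt_a0 dpart_pt. Qed.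

Lemma xpart_val (a : D) : xpart C (val a) = 0.
Proof. by rewrite -pt_a0 xpart_pt. Qed.

Lemma dpart_x : dpart C x = 0.
Proof. by rewrite -pt_01 dpart_pt. Qed.

Lemma xpart_x : xpart C x = 1.
Proof. by rewrite -pt_01 xpart_pt. Qed.

Definition generator (u : E) : Prop := u = x \/ exists a : D, u = val a.

Lemma linear_gen_ext (W : lmodType K) (f g : E -> W) :
  linear f -> linear g -> (forall u, generator u -> f u = g u) -> f =1 g.
Proof.
move=> fl gl fg e; rewrite -(ptK C e) /pt addrC fl gl.
by congr (_ *: _ + _); apply: fg; [left | right; exists (dpart C e)].
Qed.

Lemma trilinear_gen_ext (F G : E -> E -> E -> E) :
  trilinear F -> trilinear G ->
  (forall u v w, generator u -> generator v -> generator w ->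
     F u v w = G u v w) ->
  forall u v w, F u v w = G u v w.
Proof.
move=> [F1 F2 F3] [G1 G2 G3] FG u v w.
apply: (linear_gen_ext (F1 v w) (G1 v w)) => {}u gu.
apply: (linear_gen_ext (F2 u w) (G2 u w)) => {}v gv.
by apply: (linear_gen_ext (F3 u v) (G3 u v)) => {}w gw; apply: FG.
Qed.

(** * Multiplication tables *)

(** The half of a flag tuple that describes one of the two operations. Every
    argument about single products is made once for such a half. *)
Record op_datum := OpDatum {
  dl : {scalar D}; dr : {scalar D};
  dp : {linear D -> D}; dq : {linear D -> D}; da : D; dk : K }.

Record has_table (m : E -> E -> E) (B : D -> D -> D) (d : op_datum) : Prop :=
  HasTable {
  table_DD : forall a b : D, m (val a) (val b) = val (B a b);
  table_Dx : forall a : D, m (val a) x = pt (dq d a) (dl d a);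
  table_xD : forall a : D, m x (val a) = pt (dp d a) (dr d a);
  table_xx : m x x = pt (da d) (dk d) }.

Lemma table_mul (m : {bilinear E -> E -> E}) B d a b c e :
  has_table m B d ->
  m (pt a c) (pt b e) =
    pt (B a b + e *: dq d a + c *: dp d b + (c * e) *: da d)
       (e * dl d a + c * dr d b + c * e * dk d).
Proof.
move=> T; rewrite {1 2}/pt linearDl !linearDr !linearZl_LR !linearZr_LR /=.
rewrite (table_DD T) (table_Dx T) (table_xD T) (table_xx T) -pt_a0.
rewrite !ptZ !ptD; congr pt; last by ring.
by rewrite scalerA !addrA.
Qed.

Lemma table_mulxr (m : {bilinear E -> E -> E}) B d a c : has_table m B d ->
  m (pt a c) x = pt (dq d a + c *: da d) (dl d a + c * dk d).
Proof.
move=> T; rewrite /pt linearDl linearZl_LR /= (table_Dx T) (table_xx T).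
by rewrite ptZ ptD.
Qed.

Lemma table_mulxl (m : {bilinear E -> E -> E}) B d a c : has_table m B d ->
  m x (pt a c) = pt (dp d a + c *: da d) (dr d a + c * dk d).
Proof.
move=> T; rewrite /pt linearDr linearZr_LR /= (table_xD T) (table_xx T).
by rewrite ptZ ptD.
Qed.

Lemma table_mulDr (m : {bilinear E -> E -> E}) B d a b c : has_table m B d ->
  m (pt a c) (val b) = pt (B a b + c *: dp d b) (c * dr d b).
Proof.
move=> T; rewrite /pt linearDl linearZl_LR /= (table_DD T) (table_xD T).
by rewrite ptZ -pt_a0 ptD add0r.
Qed.

Lemma table_mulDl (m : {bilinear E -> E -> E}) B d a b c : has_table m B d ->
  m (val b) (pt a c) = pt (B b a + c *: dq d b) (c * dl d b).
Proof.
move=> T; rewrite /pt linearDr linearZr_LR /= (table_DD T) (table_Dx T).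
by rewrite ptZ -pt_a0 ptD add0r.
Qed.

Lemma has_table_exists (m : {bilinear E -> E -> E}) (B : D -> D -> D) :
  (forall a b, val (B a b) = m (val a) (val b)) -> exists d, has_table m B d.
Proof.
move=> mB.
have ql : linear (fun a : D => dpart C (m (val a) x)).
  by move=> c a b; rewrite linearP linearPl linearP.
have ll : scalar (fun a : D => xpart C (m (val a) x)).
  by move=> c a b; rewrite linearP linearPl linearP.
have pl : linear (fun a : D => dpart C (m x (val a))).
  by move=> c a b; rewrite linearP linearPr linearP.
have rl : scalar (fun a : D => xpart C (m x (val a))).
  by move=> c a b; rewrite linearP linearPr linearP.
exists (OpDatum (mk_scalar ll) (mk_scalar rl) (mk_linear pl) (mk_linear ql)
  (dpart C (m x x)) (xpart C (m x x))).
by split=> *; rewrite ?mB // ptK.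
Qed.

(** The product is the sum of four bilinear terms, obtained by expanding
    (a + c x)(b + e x) and reading each product off the table. *)
Lemma mul_exists (B : {bilinear D -> D -> D}) (d : op_datum) :
  exists m : {bilinear E -> E -> E}, has_table m B d.
Proof.
pose f0 u v : E := val (B (dpart C u) (dpart C v)).
pose f1 u v := xpart C v *: pt (dq d (dpart C u)) (dl d (dpart C u)).
pose f2 u v := xpart C u *: pt (dp d (dpart C v)) (dr d (dpart C v)).
pose f3 u v := (xpart C u * xpart C v) *: pt (da d) (dk d).
have ptP c a b e e' : pt (c *: a + b) (c * e + e') = c *: pt a e + pt b e'.
  by rewrite ptZ ptD.
have f0l : bilinear_for *:%R *:%R f0.
  by split=> u c v w; rewrite /f0 linearP ?linearPl ?linearPr linearP.
have f1l : bilinear_for *:%R *:%R f1.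
  split=> u c v w; rewrite /f1 !linearP /= ?ptP ?scalerDl ?scalerDr !scalerA //.
  by rewrite mulrC.
have f2l : bilinear_for *:%R *:%R f2.
  split=> u c v w; rewrite /f2 !linearP /= ?ptP ?scalerDl ?scalerDr !scalerA //.
  by rewrite mulrC.
have f3l : bilinear_for *:%R *:%R f3.
  split=> u c v w; rewrite /f3 !linearP /= scalerA -scalerDl; congr (_ *: _).
    by rewrite mulrDl mulrA.
  by rewrite mulrDr mulrCA.
have fl := bilinear_forD (bilinear_forD f0l f1l) (bilinear_forD f2l f3l).
exists (mk_bilinear fl); split=> [a b|a|a|] /=; rewrite /f0 /f1 /f2 /f3.
- by rewrite !xpart_val !dpart_val !(scale0r, mul0r, addr0).
- rewrite !xpart_val !dpart_val !xpart_x !dpart_x.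
  by rewrite !(scale0r, mul0r, addr0) scale1r linear0r raddf0 add0r.
- rewrite !xpart_val !dpart_val !xpart_x !dpart_x.
  by rewrite !(scale0r, mulr0, addr0) scale1r linear0l raddf0 !add0r.
- by rewrite !xpart_x !dpart_x mulr1 !scale1r linear0r !raddf0 !add0r !ptD
    !add0r.
Qed.

Lemma has_table_uniq m B d d' : has_table m B d -> has_table m B d' -> d = d'.
Proof.
move=> [_ mq mp ma] [_ mq' mp' ma'].
have eq b : dq d b = dq d' b /\ dl d b = dl d' b by rewrite -pt_eq -mq.
have ep b : dp d b = dp d' b /\ dr d b = dr d' b by rewrite -pt_eq -mp.
have: pt (da d) (dk d) = pt (da d') (dk d') by rewrite -ma.
rewrite pt_eq => -[].
case: d d' eq ep {mq mp ma mq' mp' ma'} => l r p q a k [l' r' p' q' a' k'] /=.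
move=> eq ep -> ->.
by congr OpDatum; apply: linear_map_ext => b;
  [case: (eq b) | case: (ep b) | case: (ep b) | case: (eq b)].
Qed.

(** * The dendriform axioms on a multiplication table *)

Definition dendriform_at (m1 m2 : E -> E -> E) (u v w : E) : Prop :=
  [/\ m1 (m1 u v + m2 u v) w = m1 u (m1 v w),
      m2 (m2 u v) w = m2 u (m1 v w + m2 v w) &
      m2 (m1 u v) w = m1 u (m2 v w)].

(** Both sides of each axiom are trilinear. *)
Lemma dendriform_gen_ext (m1 m2 : {bilinear E -> E -> E}) :
  (forall u v w, generator u -> generator v -> generator w ->
     dendriform_at m1 m2 u v w) ->
  forall u v w, dendriform_at m1 m2 u v w.
Proof.
move=> gen u v w; split; move: u v w.
- apply: trilinear_gen_ext => [|| u v w gu gv gw].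
  + have := trilinearD (trilinear_mull m1 m1) (trilinear_mull m1 m2).
    by congr trilinear; do 3!apply/funext => ?; rewrite linearDl.
  + exact: trilinear_mulr.
  + by case: (gen u v w gu gv gw).
- apply: trilinear_gen_ext => [|| u v w gu gv gw].
  + exact: trilinear_mull.
  + have := trilinearD (trilinear_mulr m2 m1) (trilinear_mulr m2 m2).
    by congr trilinear; do 3!apply/funext => ?; rewrite linearDr.
  + by case: (gen u v w gu gv gw).
- apply: trilinear_gen_ext => [|| u v w gu gv gw].
  + exact: trilinear_mull.
  + exact: trilinear_mulr.
  + by case: (gen u v w gu gv gw).
Qed.

Section DendriformTable.
Variables (A : dendriform D) (w : flag_tuple D).
Variables m1 m2 : {bilinear E -> E -> E}.

Definition succ_datum :=
  OpDatum (l1 w) (r1 w) (p1 w) (q1 w) (a1 w) (k1 w).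
Definition prec_datum :=
  OpDatum (l2 w) (r2 w) (p2 w) (q2 w) (a2 w) (k2 w).

Hypothesis T1 : has_table m1 (dsucc A) succ_datum.
Hypothesis T2 : has_table m2 (dprec A) prec_datum.

Let mulE := (table_DD T1, table_DD T2, table_Dx T1, table_Dx T2, table_xD T1,
  table_xD T2, table_xx T1, table_xx T2, valD, ptD,
  fun a c => table_mulxr a c T1, fun a c => table_mulxr a c T2,
  fun a c => table_mulxl a c T1, fun a c => table_mulxl a c T2,
  fun a b c => table_mulDr a b c T1, fun a b c => table_mulDr a b c T2,
  fun a b c => table_mulDl a b c T1, fun a b c => table_mulDl a b c T2).

Lemma dendriform_DDD (a b c : D) : dendriform_at m1 m2 (val a) (val b) (val c).
Proof. by split; rewrite !mulE ?dstar_succ ?dprec_star ?dsucc_prec. Qed.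

Local Ltac unfold_at := rewrite /dendriform_at !mulE /= !pt_eq.
Local Ltac shift e :=
  solve [apply: (eq_shift e); ring | apply: (eq_shift (esym e)); ring].

(** Each flag condition is the D component or the x component of the axioms at
    one triple of generators: (a, b, x) gives [flag2] and [flag1_l]; (x, a, b)
    gives [flag3] and [flag1_r]; (a, x, b) gives [flag4] and [flag1_lr]; then
    (x, x, a), (a, x, x), (x, a, x) and (x, x, x) give [flag5] to [flag12], two
    by two. The D components agree literally except at (x, x, x), and the x
    components agree up to cancellation of common terms. *)
Lemma is_flag_datumP :
  is_flag_datum A w <-> forall u v z, dendriform_at m1 m2 u v z.
Proof.
split=> [[f1l f1r f1lr f2 f3 f4 f5 f6 f7 f8 f9 f10 f11 f12] | ax].
  apply: dendriform_gen_ext => _ _ _ [->|[a ->]] [->|[b ->]] [->|[c ->]].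
  - unfold_at; case: f11 f12 => g1 g2 g3 [h1 h2 h3].
    split; split=> //; try by [shift h1|shift h2|shift h3].
      by rewrite !scalerDl addrCA addrC g1.
    by rewrite g2 scalerDl addrA.
  - unfold_at; case: (f5 c) (f6 c) => g1 g2 g3 [h1 h2 h3].
    by split; split=> //; [shift h1|shift h2|shift h3].
  - unfold_at; case: (f9 b) (f10 b) => g1 g2 g3 [h1 h2 h3].
    by split; split=> //; [shift h1|shift h2|shift h3].
  - unfold_at; case: (f3 b c) (f1r b c) => g1 g2 g3 [h1 h2 h3].
    by split.
  - unfold_at; case: (f7 a) (f8 a) => g1 g2 g3 [h1 h2 h3].
    by split; split=> //; [shift h1|shift h2|shift h3].
  - unfold_at; case: (f4 a c) (f1lr a c) => g1 g2 g3 h.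
    by split; split=> //; [shift h|shift h|ring].
  - unfold_at; case: (f2 a b) (f1l a b) => g1 g2 g3 [h1 h2 h3].
    by split; split=> //; [shift h1|shift h2|shift h3].
  - exact: dendriform_DDD.
split.
- move=> a b; move: (ax (val a) (val b) x); unfold_at.
  by move=> [[_ h1] [_ h2] [_ h3]]; split; [shift h1|shift h2|shift h3].
- move=> a b; move: (ax x (val a) (val b)); unfold_at.
  by move=> [[_ h1] [_ h2] [_ h3]]; split; [shift h1|shift h2|shift h3].
- move=> a b; move: (ax (val a) x (val b)); unfold_at.
  by move=> [[_ h1] [_ h2] [_ h3]]; shift h1.
- move=> a b; move: (ax (val a) (val b) x); unfold_at.
  by move=> [[h1 _] [h2 _] [h3 _]].
- move=> a b; move: (ax x (val a) (val b)); unfold_at.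
  by move=> [[h1 _] [h2 _] [h3 _]].
- move=> a b; move: (ax (val a) x (val b)); unfold_at.
  by move=> [[h1 _] [h2 _] [h3 _]].
- move=> a; move: (ax x x (val a)); unfold_at.
  by move=> [[h1 _] [h2 _] [h3 _]].
- move=> a; move: (ax x x (val a)); unfold_at.
  by move=> [[_ h1] [_ h2] [_ h3]]; split; [shift h1|shift h2|shift h3].
- move=> a; move: (ax (val a) x x); unfold_at.
  by move=> [[h1 _] [h2 _] [h3 _]].
- move=> a; move: (ax (val a) x x); unfold_at.
  by move=> [[_ h1] [_ h2] [_ h3]]; split; [shift h1|shift h2|shift h3].
- move=> a; move: (ax x (val a) x); unfold_at.
  by move=> [[h1 _] [h2 _] [h3 _]].
- move=> a; move: (ax x (val a) x); unfold_at.
  by move=> [[_ h1] [_ h2] [_ h3]]; split; [shift h1|shift h2|shift h3].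
- move: (ax x x x); unfold_at => -[[h1 _] [h2 _] [h3 _]]; split=> //.
    by apply: (addIr (k1 w *: a1 w)); rewrite -h1 scalerDl addrAC addrA.
  by apply: (addIr (k2 w *: a2 w)); rewrite h2 scalerDl addrA.
- move: (ax x x x); unfold_at.
  by move=> [[_ h1] [_ h2] [_ h3]]; split; [shift h1|shift h2|shift h3].
Qed.

End DendriformTable.

(** * Transport along a linear map fixing the subspace *)

(** The half of [flag_transform] that concerns one operation. *)
Record op_transform (g : D) (h : K) (B : D -> D -> D) (d d' : op_datum) :
    Prop := OpTransform {
  transform_l : forall a, dl d' a = dl d a;
  transform_r : forall a, dr d' a = dr d a;
  transform_p : forall a, dp d' a = h^-1 *: (dp d a + dr d a *: g - B g a);
  transform_q : forall a, dq d' a = h^-1 *: (dq d a + dl d a *: g - B a g);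
  transform_a : da d' = h ^- 2 *: (da d + dk d *: g - dq d g - dl d g *: g
                                   + B g g - dp d g - dr d g *: g);
  transform_k : dk d' = h^-1 * (dk d - dl d g - dr d g) }.

Lemma solve_scale (V : lmodType K) (h : K) (u v z : V) :
  h != 0 -> (u = v + h *: z) = (z = h^-1 *: (u - v)) :> Prop.
Proof.
move=> h0; apply/propext; split=> ->.
  by rewrite addrC addKr scalerA mulVf // scale1r.
by rewrite scalerA divff // scale1r addrC subrK.
Qed.

Section Transport.
Variables (m m' : {bilinear E -> E -> E}) (B : {bilinear D -> D -> D}).
Variables (d d' : op_datum).
Hypotheses (T : has_table m B d) (T' : has_table m' B d').
Variables (psi : {linear E -> E}) (g : D) (h : K).
Hypotheses (h0 : h != 0) (psiD : forall a : D, psi (val a) = val a).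
Hypothesis psix : psi x = pt g h.

Lemma psi_pt a c : psi (pt a c) = pt (a + c *: g) (c * h).
Proof. by rewrite /pt linearD linearZ /= psiD psix ptZ -pt_a0 ptD add0r. Qed.

Lemma transport_Dx a : (psi (m (val a) x) = m' (psi (val a)) (psi x)) =
  (dq d' a = h^-1 *: (dq d a + dl d a *: g - B a g) /\ dl d' a = dl d a)
  :> Prop.
Proof.
rewrite (table_Dx T) psi_pt psiD psix (table_mulDl _ _ _ T') pt_eq.
rewrite solve_scale // [_ * h]mulrC; congr (_ /\ _); apply/propext.
by split=> [/(mulfI h0)|->].
Qed.

Lemma transport_xD a : (psi (m x (val a)) = m' (psi x) (psi (val a))) =
  (dp d' a = h^-1 *: (dp d a + dr d a *: g - B g a) /\ dr d' a = dr d a)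
  :> Prop.
Proof.
rewrite (table_xD T) psi_pt psiD psix (table_mulDr _ _ _ T') pt_eq.
rewrite solve_scale // [_ * h]mulrC; congr (_ /\ _); apply/propext.
by split=> [/(mulfI h0)|->].
Qed.

(** The equation for the square of x also involves the products of g with x for
    the target operation; the two hypotheses express them by the source. *)
Lemma transport_xx :
  (dq d' g = h^-1 *: (dq d g + dl d g *: g - B g g) /\ dl d' g = dl d g) ->
  (dp d' g = h^-1 *: (dp d g + dr d g *: g - B g g) /\ dr d' g = dr d g) ->
  (psi (m x x) = m' (psi x) (psi x)) =
  (da d' = h ^- 2 *: (da d + dk d *: g - dq d g - dl d g *: g
                      + B g g - dp d g - dr d g *: g) /\
   dk d' = h^-1 * (dk d - dl d g - dr d g)) :> Prop.
Proof.
move=> [eq el] [ep er].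
rewrite (table_xx T) psi_pt psix (table_mul _ _ _ _ T') pt_eq el er -expr2.
rewrite solve_scale ?expf_neq0 //; congr (_ /\ _).
  congr (_ = _ *: _); rewrite eq ep !scalerA divff // !scale1r.
  have cancel S Q P : S + (Q - S) + (P - S) = Q + (P - S) :> D.
    by rewrite (addrC S) subrK.
  rewrite cancel !opprD !opprK !addrA.
  by rewrite [in RHS](addrAC _ (B g g)) [RHS]addrAC.
apply/propext; split=> [e|->]; last by field.
apply: (mulfI h0); apply: (mulfI h0); rewrite mulVKf //.
by rewrite mulrA; apply: (eq_shift (esym e)); ring.
Qed.

(** The products of D with x, of x with D, and of x with itself give the
    transformation of (q, l), of (p, r) and of (a, k) respectively, while
    products inside D are always preserved. *)
Lemma morph_transformP :
  {morph psi : u v / m u v >-> m' u v} <-> op_transform g h B d d'.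
Proof.
split=> [mor | [tl tr tp tq ta tk]].
  have Dx (a : D) := mor (val a) x.
  have xD (a : D) := mor x (val a).
  have xx := mor x x.
  move: xx; rewrite transport_xx -?transport_Dx -?transport_xD // => -[ta tk].
  by split=> // a; [move: (Dx a)|move: (xD a)|move: (xD a)|move: (Dx a)];
    rewrite ?transport_Dx ?transport_xD => -[].
move=> u v; move: u.
apply: linear_gen_ext => [c u z|c u z|_ [->|[a ->]]].
- by rewrite linearPl linearP.
- by rewrite linearP linearPl.
- move: v; apply: linear_gen_ext => [c u z|c u z|_ [->|[a ->]]].
  + by rewrite linearPr linearP.
  + by rewrite linearP linearPr.
  + by rewrite transport_xx.
  + by rewrite transport_xD.
- move: v; apply: linear_gen_ext => [c u z|c u z|_ [->|[b ->]]].
  + by rewrite linearPr linearP.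
  + by rewrite linearP linearPr.
  + by rewrite transport_Dx.
  + by rewrite !psiD (table_DD T) (table_DD T') psiD.
Qed.

End Transport.

(** * Extensions and flag datums *)

Section Extensions.
Variable A : dendriform D.

Lemma flag_transformP g h (w w' : flag_tuple D) :
  flag_transform A g h w w' <->
  op_transform g h (dsucc A) (succ_datum w) (succ_datum w') /\
  op_transform g h (dprec A) (prec_datum w) (prec_datum w').
Proof.
split=> [[tl tr tp tq [? ?] [? ?]] | [[? ? ? ? ? ?] [? ? ? ? ? ?]]].
  by split; split=> // a;
    [case: (tl a)|case: (tr a)|case: (tp a)|case: (tq a)
    |case: (tl a)|case: (tr a)|case: (tp a)|case: (tq a)].
by split.
Qed.

Definition has_flag (s : exts A) (w : flag_tuple D) : Prop :=
  has_table (dsucc s) (dsucc A) (succ_datum w) /\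
  has_table (dprec s) (dprec A) (prec_datum w).

Lemma has_flag_exists (s : exts A) : exists w : flag_datum A, has_flag s w.
Proof.
have [d1 T1] := has_table_exists (exts_succ s).
have [d2 T2] := has_table_exists (exts_prec s).
pose w := FlagTuple (dl d1) (dl d2) (dr d1) (dr d2) (dp d1) (dp d2) (dq d1)
  (dq d2) (da d1) (da d2) (dk d1) (dk d2).
have {}T1 : has_table (dsucc s) (dsucc A) (succ_datum w) by case: d1 @w T1.
have {}T2 : has_table (dprec s) (dprec A) (prec_datum w) by case: d2 @w T1 T2.
suff F : is_flag_datum A w by exists (FlagDatum F).
apply/(is_flag_datumP T1 T2) => u v z.
by split; [exact: dstar_succ | exact: dprec_star | exact: dsucc_prec].
Qed.

Lemma has_flag_uniq (s : exts A) (w w' : flag_datum A) :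
  has_flag s w -> has_flag s w' -> w = w'.
Proof.
case: w w' => w wP [w' wP'] [/= T1 T2] [/= T1' T2'].
have e : w = w'.
  have := has_table_uniq T2 T2'; have := has_table_uniq T1 T1'.
  case: w w' {wP wP' T1 T2 T1' T2'} => ? ? ? ? ? ? ? ? ? ? ? ? [] >.
  by move=> [-> -> -> -> -> ->] [-> -> -> -> -> ->].
by subst w'; rewrite (Prop_irrelevance wP wP').
Qed.

Lemma exts_of_flag (w : flag_datum A) : exists s : exts A, has_flag s w.
Proof.
have [m1 T1] := mul_exists (dsucc A) (succ_datum w).
have [m2 T2] := mul_exists (dprec A) (prec_datum w).
have ax := (is_flag_datumP T1 T2).1 (flag_valP w).
have ax1 u v z : m1 (m1 u v + m2 u v) z = m1 u (m1 v z) by case: (ax u v z).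
have ax2 u v z : m2 (m2 u v) z = m2 u (m1 v z + m2 v z) by case: (ax u v z).
have ax3 u v z : m2 (m1 u v) z = m1 u (m2 v z) by case: (ax u v z).
pose S := Dendriform ax1 ax2 ax3.
have S1 (a b : D) : val (a \succ[A] b) = val a \succ[S] val b.
  by rewrite (table_DD T1).
have S2 (a b : D) : val (a \prec[A] b) = val a \prec[S] val b.
  by rewrite (table_DD T2).
by exists (Exts S1 S2).
Qed.

Lemma shear_exists g h : exists psi : {linear E -> E},
  (forall a : D, psi (val a) = val a) /\ psi x = pt g h.
Proof.
have fl : linear (fun e => val (dpart C e) + xpart C e *: pt g h).
  move=> c u v; rewrite !linearP /= scalerDl -scalerA addrACA.
  by rewrite [in RHS]scalerDr.
exists (mk_linear fl); split=> [a|] /=.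
  by rewrite dpart_val xpart_val scale0r addr0.
by rewrite dpart_x xpart_x raddf0 add0r scale1r.
Qed.

(** If h = 0 then x and g have the same image; otherwise the inverse is the
    linear map that fixes D and sends x to h^-1 (x - g). *)
Lemma shear_bijective (psi : {linear E -> E}) g h :
  (forall a : D, psi (val a) = val a) -> psi x = pt g h ->
  bijective psi <-> h != 0.
Proof.
move=> psiD psix; split=> [[phi phiK _] | h0].
  apply/eqP => h0; move: psix; rewrite h0 pt_a0 -psiD => /(can_inj phiK).
  rewrite -pt_a0 -pt_01 pt_eq => -[_ /eqP].
  by rewrite oner_eq0.
have [phi [phiD phix]] := shear_exists (- (h^-1 *: g)) h^-1.
exists phi; apply: linear_gen_ext => [c u v|//|_ [->|[a ->]]];
  rewrite ?linearP //=.
- rewrite psix (psi_pt phiD phix) mulfV // -[RHS]pt_01; congr pt.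
  by rewrite scalerN scalerA mulfV // scale1r subrr.
- by rewrite psiD phiD.
- rewrite phix (psi_pt psiD psix) mulVf // -[RHS]pt_01; congr pt.
  by rewrite addrC subrr.
- by rewrite phiD psiD.
Qed.

Lemma iso_flag_transform (s t : exts A) (w w' : flag_tuple D)
    (psi : {linear E -> E}) g h :
  has_flag s w -> has_flag t w' -> (forall a : D, psi (val a) = val a) ->
  psi x = pt g h ->
  dendriform_iso s t psi <-> h != 0 /\ flag_transform A g h w w'.
Proof.
move=> [T1 T2] [T1' T2'] psiD psix; split=> [[bij mor1 mor2] | [h0]].
  have h0 := (shear_bijective psiD psix).1 bij.
  split=> //; apply/flag_transformP; split.
    exact: (morph_transformP T1 T1' h0 psiD psix).1.
  exact: (morph_transformP T2 T2' h0 psiD psix).1.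
move=> /flag_transformP [tr1 tr2]; split.
- exact: (shear_bijective psiD psix).2.
- exact: (morph_transformP T1 T1' h0 psiD psix).2.
- exact: (morph_transformP T2 T2' h0 psiD psix).2.
Qed.

Lemma exts_equiv_flag (s t : exts A) (w w' : flag_datum A) :
  has_flag s w -> has_flag t w' -> exts_equiv s t <-> flag_equiv w w'.
Proof.
move=> sw tw'; split=> [[psi [iso psiD]] | [g [h h0 tr]]].
  have psix : psi x = pt (dpart C (psi x)) (xpart C (psi x)) by rewrite ptK.
  have [h0 tr] := (iso_flag_transform sw tw' psiD psix).1 iso.
  by exists (dpart C (psi x)), (xpart C (psi x)).
have [psi [psiD psix]] := shear_exists g h.
by exists psi; split=> //; apply/(iso_flag_transform sw tw' psiD psix).
Qed.

End Extensions.

End Coordinates.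

(** * The associated flag datum *)

Section Complement.
Variables (K : fieldType) (E : lmodType K) (SD SV : pred E).
Variables (D : subLmodType SD) (V : subLmodType SV) (A : dendriform D) (x : V).
Hypotheses (hV : space_complement D V) (hx : singleton_basis x).

(** The difference of two representations lies both in D and in V. *)
Lemma pt_inj (a b : D) c d :
  pt (val x) a c = pt (val x) b d -> a = b /\ c = d.
Proof.
rewrite /pt => e.
have ab : val (a - b) = val ((d - c) *: x).
  rewrite raddfB linearZ /= scalerBl; apply/eqP.
  by rewrite subr_eq addrAC [_ + val b]addrC -e addrK.
have ab0 : val (a - b) = 0.
  by apply: hV.2; [exact: valP | rewrite ab; exact: valP].
split.
  by apply/subr0_eq/val_inj; rewrite ab0 raddf0.
apply/esym/subr0_eq/hx.1/val_inj.
by rewrite -ab ab0 raddf0.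
Qed.

Lemma adapted_coord_exists : inhabited (adapted_coord D (val x)).
Proof.
have /choice [f fK] : forall e : E, exists ac : D * K, pt (val x) ac.1 ac.2 = e.
  move=> e; have [a [v ->]] := hV.1 e; have [c ->] := hx.2 v.
  by exists (a, c); rewrite /pt linearZ.
have fP c u v : (f (c *: u + v)).1 = c *: (f u).1 + (f v).1 /\
                (f (c *: u + v)).2 = c * (f u).2 + (f v).2.
  by apply: pt_inj; rewrite fK -ptD -ptZ !fK.
have dlin : linear (fun e => (f e).1) by move=> c u v; case: (fP c u v).
have xlin : scalar (fun e => (f e).2) by move=> c u v; case: (fP c u v).
constructor; apply: (@AdaptedCoord _ _ _ _ _ (mk_linear dlin) (mk_scalar xlin)).
- exact: fK.
- by move=> a c /=; case: (pt_inj (fK (pt (val x) a c))).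
- by move=> a c /=; case: (pt_inj (fK (pt (val x) a c))).
Qed.

Lemma proj_along_pt (a : D) c :
  proj_along D V (pt (val x) a c) = a /\
  proj_along V D (pt (val x) a c) = c *: x.
Proof.
have uniq (b b' : D) (v v' : V) :
    val b + val v = val b' + val v' -> b = b' /\ v = v'.
  have [d ->] := hx.2 v; have [d' ->] := hx.2 v'.
  by rewrite !linearZ => /pt_inj [-> ->].
split.
  apply: xget_subset1; first by exists (c *: x); rewrite linearZ.
  by move=> b b' [v ->] [v' /uniq []].
apply: xget_subset1; first by exists a; rewrite linearZ addrC.
by move=> v v' [b ->] [b']; rewrite addrC [RHS]addrC => /uniq [].
Qed.

Lemma pt_projE (e : E) (a : D) c :
  (e = pt (val x) a c) =
  (a = proj_along D V e /\ c *: x = proj_along V D e) :> Prop.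
Proof.
apply/propext; split=> [-> | [-> cx]].
  by have [-> ->] := proj_along_pt a c.
have [C] := adapted_coord_exists.
move: cx; rewrite -{1 2 3}(ptK C e).
have [-> ->] := proj_along_pt (dpart C e) (xpart C e).
by move=> cx; rewrite /pt -!linearZ /= cx linearZ.
Qed.

Lemma flag_associatedP (s : exts A) (w : flag_tuple D) :
  flag_associated x s w <-> has_flag (val x) s w.
Proof.
split=> [[al ar ap aq aa ak] | [[T1D T1q T1p T1a] [T2D T2q T2p T2a]]].
  split; split=> [a b|a|a|].
  - by rewrite (exts_succ s).
  - by rewrite pt_projE; case: (al a) (aq a) => ? ? [].
  - by rewrite pt_projE; case: (ar a) (ap a) => ? ? [].
  - by rewrite pt_projE; case: aa ak => ? ? [].
  - by rewrite (exts_prec s).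
  - by rewrite pt_projE; case: (al a) (aq a) => ? ? [].
  - by rewrite pt_projE; case: (ar a) (ap a) => ? ? [].
  - by rewrite pt_projE; case: aa ak => ? ? [].
split=> [a|a|a|a||].
- by move: (T1q a) (T2q a); rewrite !pt_projE => -[_ ?] [_ ?].
- by move: (T1p a) (T2p a); rewrite !pt_projE => -[_ ?] [_ ?].
- by move: (T1p a) (T2p a); rewrite !pt_projE => -[? _] [? _].
- by move: (T1q a) (T2q a); rewrite !pt_projE => -[? _] [? _].
- by move: T1a T2a; rewrite !pt_projE => -[? _] [? _].
- by move: T1a T2a; rewrite !pt_projE => -[_ ?] [_ ?].
Qed.

(** Since psi x has component h x along V, commuting with the projection onto V
    forces h = 1. *)
Lemma exts_cohom_flag (s t : exts A) (w w' : flag_datum A) :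
  has_flag (val x) s w -> has_flag (val x) t w' ->
  exts_cohom V s t <-> flag_cohom w w'.
Proof.
have [C] := adapted_coord_exists.
move=> sw tw'; split=> [[psi [iso psiD psiV]] | [g tr]].
  have psix : psi (val x) = pt (val x) (dpart C (psi (val x))) 1.
    rewrite -[LHS](ptK C); congr pt.
    have [_ pi_psi] :=
      proj_along_pt (dpart C (psi (val x))) (xpart C (psi (val x))).
    have [_ pi_x] := proj_along_pt 0 1.
    rewrite ptK psiV -[in LHS](pt_01 D (val x)) pi_x in pi_psi.
    move/esym: pi_psi.
    move/eqP; rewrite -subr_eq0 -scalerBl => /eqP /hx.1.
    exact: subr0_eq.
  have [_ tr] := (iso_flag_transform C sw tw' psiD psix).1 iso.
  by exists (dpart C (psi (val x))).
have [psi [psiD psix]] := shear_exists C g 1.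
exists psi; split=> //.
  by apply/(iso_flag_transform C sw tw' psiD psix); rewrite oner_neq0.
move=> e; rewrite -(ptK C e) (psi_pt psiD psix) mulr1.
by rewrite (proj_along_pt _ _).2 (proj_along_pt _ _).2.
Qed.

End Complement.

(** * The equivalence relations on extensions *)

Section ExtsRelations.
Variables (K : fieldType) (E : lmodType K) (SD SV : pred E).
Variables (D : subLmodType SD) (V : subLmodType SV) (A : dendriform D).

Lemma dendriform_iso_id (S : dendriform E) :
  dendriform_iso S S (mk_linear (fun c u v => erefl (c *: u + v))).
Proof. by split=> //; exists id. Qed.

Lemma dendriform_iso_comp (S T U : dendriform E) (f g : {linear E -> E}) :
  dendriform_iso S T f -> dendriform_iso T U g -> dendriform_iso S U (g \o f).
Proof.
move=> [fb f1 f2] [gb g1 g2]; split; first exact: bij_comp.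
  by move=> u v /=; rewrite f1 g1.
by move=> u v /=; rewrite f2 g2.
Qed.

Lemma dendriform_iso_inv (S T : dendriform E) (f : {linear E -> E}) :
  dendriform_iso S T f -> exists2 g : {linear E -> E},
    dendriform_iso T S g & cancel f g /\ cancel g f.
Proof.
move=> [[g fK gK] f1 f2].
have gl : linear g by apply: can2_linear fK gK.
exists (mk_linear gl); last by [].
split=> [|u v|u v]; first by exists f.
  by apply: (can_inj fK); rewrite f1 /= !gK.
by apply: (can_inj fK); rewrite f2 /= !gK.
Qed.

Lemma exts_equiv_equivalence : Equivalence (@exts_equiv _ _ _ D A).
Proof.
split=> [s | s t [f [iso fD]] | s t u [f [isof fD]] [g [isog gD]]].
- by eexists; split; first exact: dendriform_iso_id.
- have [g isog [fK gK]] := dendriform_iso_inv iso.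
  by exists g; split=> // a; rewrite -{1}fD fK.
- exists (g \o f); split; first exact: dendriform_iso_comp isof isog.
  by move=> a /=; rewrite fD gD.
Qed.

Lemma exts_cohom_equivalence : Equivalence (@exts_cohom _ _ _ _ D V A).
Proof.
split=> [s | s t [f [iso fD fV]] | s t u [f [isof fD fV]] [g [isog gD gV]]].
- by eexists; split; first exact: dendriform_iso_id.
- have [g isog [fK gK]] := dendriform_iso_inv iso.
  by exists g; split=> // a; [rewrite -{1}fD fK | rewrite -fV gK].
- exists (g \o f); split; first exact: dendriform_iso_comp isof isog.
    by move=> a /=; rewrite fD gD.
  by move=> e /=; rewrite gV fV.
Qed.

End ExtsRelations.

(** * Quotients by corresponding equivalence relations *)

Section Quotients.

Lemma class_of_eq (T : Type) (R : T -> T -> Prop) (s t : T) : Equivalence R ->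
  (class_of R s = class_of R t) = R s t :> Prop.
Proof.
move=> [refl sym trans]; apply/propext; split=> [|Rst].
  move/(congr1 (fun c : quotient R => proj1_sig c t)) => /= ->; exact: refl.
apply: eq_exist; apply/funext => u; apply/propext; split=> [Rsu|Rtu].
  exact: trans (sym _ _ Rst) Rsu.
exact: trans Rst Rtu.
Qed.

Lemma class_of_surj (T : Type) (R : T -> T -> Prop) (c : quotient R) :
  exists s, c = class_of R s.
Proof. by case: c => P [s eP]; exists s; apply: eq_exist. Qed.

(** The relation S is the preimage of R along a choice, for each element of U, of
    an element of T related to it, so it inherits the properties of R. *)
Lemma quotient_bijection (T U : Type) (R : T -> T -> Prop) (S : U -> U -> Prop)
    (rel : T -> U -> Prop) :
  (forall s, exists w, rel s w) -> (forall w, exists s, rel s w) ->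
  (forall s t w w', rel s w -> rel t w' -> R s t <-> S w w') ->
  Equivalence R ->
  Equivalence S /\
  exists F : quotient R -> quotient S,
    bijective F /\ forall s w, rel s w -> F (class_of R s) = class_of S w.
Proof.
move=> /choice [f fP] /choice [g gP] RS eR.
have SR w w' : S w w' <-> R (g w) (g w') by apply: iff_sym; apply: RS.
have eS : Equivalence S.
  case: eR => refl sym trans; split=> [w|w w'|u v w]; rewrite !SR.
  - exact: refl.
  - exact: sym.
  - exact: trans.
split=> //.
have /choice [r rP] := @class_of_surj _ R.
have /choice [q qP] := @class_of_surj _ S.
exists (fun c => class_of S (f (r c))).
have FE s w : rel s w -> class_of S (f (r (class_of R s))) = class_of S w.
  move=> sw; rewrite class_of_eq //; apply/(RS _ _ _ _ (fP _) sw).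
  by rewrite -class_of_eq // -rP.
split=> //; exists (fun c => class_of R (g (q c))) => c.
  rewrite [RHS]rP class_of_eq //; apply/(RS _ _ _ _ (gP _) (fP _)).
  by rewrite -class_of_eq // -qP.
by rewrite (FE _ _ (gP _)) -qP.
Qed.

End Quotients.

(** * Classification *)

Theorem theorem3p20 (R : realType) (E : lmodType R[i]) (SD SV : pred E)
    (D : subLmodType SD) (V : subLmodType SV) (A : dendriform D) (x : V)
    (hV : space_complement D V) (hx : singleton_basis x) :
  (forall s : exts A, exists! w : flag_datum A, flag_associated x s w) /\
  (Equivalence (@flag_equiv _ _ A) /\
   exists Upsilon : Extd A -> H2 A,
     bijective Upsilon /\
     forall (s : exts A) (w : flag_datum A), flag_associated x s w ->
       Upsilon (class_of (@exts_equiv _ _ _ _ A) s)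
         = class_of (@flag_equiv _ _ A) w) /\
  (Equivalence (@flag_cohom _ _ A) /\
   exists Upsilon' : Extd' V A -> H2_V A,
     bijective Upsilon' /\
     forall (s : exts A) (w : flag_datum A), flag_associated x s w ->
       Upsilon' (class_of (@exts_cohom _ _ _ _ D V A) s)
         = class_of (@flag_cohom _ _ A) w).
Proof.
have [C] := adapted_coord_exists hV hx.
have assoc_exists (s : exts A) : exists w : flag_datum A, flag_associated x s w.
  by have [w sw] := has_flag_exists C s; exists w; apply/flag_associatedP.
have assoc_surj (w : flag_datum A) : exists s : exts A, flag_associated x s w.
  by have [s sw] := exts_of_flag C w; exists s; apply/flag_associatedP.
split; last split.
- move=> s; have [w sw] := assoc_exists s; exists w; split=> // w'.
  move: sw => /(flag_associatedP hV hx) sw /(flag_associatedP hV hx).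
  exact: has_flag_uniq.
- apply: quotient_bijection assoc_exists assoc_surj _ (exts_equiv_equivalence _).
  move=> s t w w' /(flag_associatedP hV hx) sw /(flag_associatedP hV hx).
  exact: exts_equiv_flag.
- apply: quotient_bijection assoc_exists assoc_surj _ (exts_cohom_equivalence _ _).
  move=> s t w w' /(flag_associatedP hV hx) sw /(flag_associatedP hV hx).
  exact: exts_cohom_flag.
Qed.
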